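(* Let $n, d_0\geq 1$ be positive integers and let $S\subseteq \mathbb{Z}^n$ be a finite generating set. Then there is a positive integer $\Delta$ and a clopen subset $M\subseteq F(2^{\mathbb{Z}^n})$ such that (1) for any distinct $x,y\in M$ in the same orbit, $\rho(x,y)\geq d_0$; (2) for any $v\in S$ and any $x\in F(2^{\mathbb{Z}^n})$, there are non-negative integers $a, b\leq \Delta$ such that $(av)\cdot x\in M$ and $(-bv)\cdot x\in M$.
   Context: $2^{\mathbb{Z}^n}=\{0,1\}^{\mathbb{Z}^n}$ carries the product topology (with $\{0,1\}$ discrete). The Bernoulli shift action of $\mathbb{Z}^n$ on $2^{\mathbb{Z}^n}$ is $(g\cdot x)(h)=x(g+h)$ for $g,h\in\mathbb{Z}^n$, $x\in 2^{\mathbb{Z}^n}$. Its free part is $F(2^{\mathbb{Z}^n})=\{x\in 2^{\mathbb{Z}^n}: \forall g\in\mathbb{Z}^n\ (g\neq\overline{0}\Rightarrow g\cdot x\neq x)\}$, where $\overline{0}=(0,\dots,0)$, with the subspace topology; ''clopen'' means clopen in $F(2^{\mathbb{Z}^n})$. ''Generating set'' means a generating set of the group $\mathbb{Z}^n$. The orbit of $x$ is $\mathbb{Z}^n\cdot x$. For $x,y\in F(2^{\mathbb{Z}^n})$ in the same orbit, $\rho(x,y)=\|g\|_2$ (Euclidean norm), where $g\in\mathbb{Z}^n$ is the unique element with $g\cdot x=y$.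
   Formalization: The generating set S is assumed not to contain the zero vector; if 0 is in S and d_0 ≥ 2, condition (2) with v = 0 forces M to be the whole free part, which contradicts (1). *)

(* Defs.v *)
From HB Require Import structures.
From mathcomp Require Import all_boot all_order all_algebra.
From mathcomp Require Import all_classical all_reals.
From mathcomp Require Import topology.

Set Implicit Arguments.
Unset Strict Implicit.
Unset Printing Implicit Defensive.

Import Order.TTheory GRing.Theory Num.Theory.
Local Open Scope classical_set_scope.
Local Open Scope ring_scope.

Definition shift_space (n : nat) : Type :=
  prod_topology (fun _ : 'rV[int]_n => bool).

HB.instance Definition _ n := Topological.on (shift_space n).

Definition bshift n (g : 'rV[int]_n) (x : shift_space n) : shift_space n :=
  fun h => x (g + h).

Definition free_part n : set (shift_space n) :=
  [set x | forall g : 'rV[int]_n, g <> 0 -> bshift g x <> x].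

Definition shift_orbit n (x : shift_space n) : set (shift_space n) :=
  range (fun g : 'rV[int]_n => bshift g x).

(* [set_type A] carries the initial topology of its inclusion [set_val]. *)
Definition clopen_in (T : topologicalType) (A M : set T) :=
  M `<=` A /\ clopen (set_val @^-1` M : set (set_type A)).

Definition is_subgroup (V : zmodType) (H : set V) :=
  H 0 /\ forall g h, H g -> H h -> H (g - h).

Definition generates (V : zmodType) (S : set V) :=
  smallest (@is_subgroup V) S = [set: V].

Definition norm2 (R : realType) n (g : 'rV[int]_n) : R :=
  Num.sqrt (\sum_(i < n) (g 0 i)%:~R ^+ 2).

(* The [g] with [bshift g x = y] is unique when [x] and [y] lie in the same
   orbit of the free part; [rho R x y] is meaningful only in that case. *)
Definition rho (R : realType) n (x y : shift_space n) : R :=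
  norm2 R (xget 0 [set g : 'rV[int]_n | bshift g x = y]).

(* Main.v *)
Require Import Defs.
From mathcomp Require Import all_boot all_order all_algebra.
From mathcomp Require Import all_classical all_reals.
From mathcomp Require Import topology.
From mathcomp Require Import zify.

(** The directions in [S] are treated one after the other. Each direction [v]
    gets its own clopen marker set, which meets every [v]-line with bounded gaps
    and stays away from the marker sets of the earlier directions; [M] is their
    union. Two observations make this possible.

    - A marker set for [v] can be found inside any clopen set [U] of allowed
      points that meets every run of [N] consecutive points of every [v]-line
      ([exists_line_markers]). It can also be made as sparse as wished: no two
      of its points differ by an element of a given finite set [T]. It suffices
      to take a maximal subset of [U] whose points differ neither by an element
      of [T] or [- T], nor by a short multiple of [v]. Suppose that a long
      stretch of a [v]-line missed it. By maximality each allowed point there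
      has a conflict, which must come from [T] or [- T]; two allowed points
      with the same conflict vector would yield two markers differing by a short
      multiple of [v]; so there are at most twice as many allowed points as
      elements of [T], although a long stretch has many of them.

    - If the earlier marker sets are sparse along the later directions, they
      leave enough room: let [B] be the finite set of vectors to be avoided and
      suppose that no marker set contains two points differing by a multiple
      [v *+ t] with [0 < t < N]. Each pair of an earlier direction and a vector
      of [B] then forbids at most one of [N] consecutive points of a [v]-line,
      so an allowed point remains as soon as [N] exceeds the number of pairs
      ([exists_marker_family]). Since [N] depends only on [S] and [B], the set
      [T] that expresses the sparseness can be fixed at the start.

    Clopen maximal sets exist ([exists_maximal]) because the free part has a
    continuous colouring by natural numbers in which points that differ by a
    nonzero element of a given finite set receive different colours
    ([exists_coloring]): freeness is witnessed by finitely many coordinates, and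
    these serve as the colour. A point is then put in the maximal set when no
    point of smaller colour in conflict with it has been, which only
    involves finitely many coordinates.

    Backward gaps are bounded because forward gaps are: start further back. *)

Import Order.TTheory GRing.Theory Num.Theory.
Local Open Scope classical_set_scope.
Local Open Scope ring_scope.

(** * Preliminaries *)

Lemma pigeonhole (E : eqType) (s : seq E) (N : nat) (f : nat -> E) :
    (forall i, (i < N)%N -> f i \in s) -> (size s < N)%N ->
  exists i j, [/\ (i < j)%N, (j < N)%N & f i = f j].
Proof.
move=> fs ltsN.
case: (boolP (uniq [seq f i | i <- iota 0 N])) => [u | /(uniqPn (f 0%N))].
  have /(uniq_leq_size u) : {subset [seq f i | i <- iota 0 N] <= s}.
    by move=> _ /mapP[i + ->]; rewrite mem_iota => /fs.
  by rewrite size_map size_iota leqNgt ltsN.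
rewrite size_map size_iota => -[i [j [ltij ltjN]]].
rewrite !(nth_map 0%N) ?size_iota ?nth_iota ?(ltn_trans ltij) // !add0n.
by exists i, j.
Qed.

Lemma mulrn_row_eq0 n (v : 'rV[int]_n) (k : nat) :
  v != 0 -> v *+ k = 0 -> k = 0%N.
Proof.
move=> v0 e; apply/eqP; apply: contraNT v0 => k0; apply/eqP/rowP => i.
have /eqP := congr1 (fun w : 'rV[int]_n => w 0 i) e.
by rewrite mxE mulmxnE mulrn_eq0 (negPf k0) => /eqP.
Qed.

(** * The shift action and its locally constant functions *)

Lemma bshiftD {n} (g h : 'rV[int]_n) (x : shift_space n) :
  bshift g (bshift h x) = bshift (g + h) x.
Proof. by apply/funext => k; rewrite /bshift addrA (addrC h). Qed.

Lemma bshift0 {n} (x : shift_space n) : bshift 0 x = x.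
Proof. by apply/funext => k; rewrite /bshift add0r. Qed.

Lemma free_part_bshift {n} (g : 'rV[int]_n) (x : shift_space n) :
  free_part x -> free_part (bshift g x).
Proof.
move=> fx h /fx hx e; apply: hx.
by rewrite -[x in RHS]bshift0 -(addNr g) -bshiftD -e !bshiftD addrAC addNr add0r.
Qed.

(** Continuity into a discrete space, relative to the free part, in terms of
    coordinates. This form is stable under the finite combinations below, and
    topology only enters through [clopen_of_lc]. *)
Definition locally_constant {n} {A : Type} (f : shift_space n -> A) :=
  forall x, free_part x -> exists w : seq 'rV[int]_n, forall y, free_part y ->
    {in w, forall h, y h = x h} -> f y = f x.

Lemma lc_const {n} {A : Type} (a : A) :
  locally_constant (fun _ : shift_space n => a).
Proof. by move=> x _; exists [::]. Qed.

Lemma lc_eval {n} (h : 'rV[int]_n) :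
  locally_constant (fun x : shift_space n => x h).
Proof. by move=> x _; exists [:: h] => y _; apply; rewrite inE. Qed.

(** Gluing of local definitions: the index [r x] of the one in force is itself
    locally constant, so only one of them matters near a given point. Continuous choices made by stages, such as
    the decision at stage [c x] in [exists_maximal], have this shape. *)
Lemma lc_bind {n} {I A : Type} (r : shift_space n -> I) F :
    locally_constant r -> (forall i, locally_constant (F i)) ->
  locally_constant (fun x => F (r x) x : A).
Proof.
move=> lr lF x fx; have [w1 h1] := lr x fx; have [w2 h2] := lF (r x) x fx.
exists (w1 ++ w2) => y fy yx; rewrite h1 => [|//|h hw].
  by apply: h2 => // h hw; apply: yx; rewrite mem_cat hw orbT.
by apply: yx; rewrite mem_cat hw.
Qed.

Lemma lc_comp {n} {A B : Type} (p : A -> B) (f : shift_space n -> A) :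
  locally_constant f -> locally_constant (fun x => p (f x)).
Proof. by move=> lf; apply: lc_bind lf (fun _ => lc_const _). Qed.

Lemma lc_shift {n} {A : Type} (g : 'rV[int]_n) (f : shift_space n -> A) :
  locally_constant f -> locally_constant (fun x => f (bshift g x)).
Proof.
move=> lf x fx; have [w hw] := lf _ (free_part_bshift g _ fx).
exists [seq g + h | h <- w] => y fy yx; apply: hw; first exact: free_part_bshift.
by move=> h hw; apply: yx; apply: map_f.
Qed.

Lemma lc_map {n} {I : eqType} {A : Type} (s : seq I)
    (F : I -> shift_space n -> A) :
    {in s, forall i, locally_constant (F i)} ->
  locally_constant (fun x => [seq F i x | i <- s]).
Proof.
elim: s => [|i s IHs] lF /=; first exact: lc_const.
apply: (lc_bind (F i) (fun b x => b :: _)) => [|b].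
  exact: lF (mem_head _ _).
by apply: lc_comp; apply: IHs => j js; apply: lF; rewrite inE js orbT.
Qed.

Lemma lc_all {n} {I : eqType} (s : seq I) (F : I -> shift_space n -> bool) :
    {in s, forall i, locally_constant (F i)} ->
  locally_constant (fun x => all (fun i => F i x) s).
Proof.
move=> lF; have := lc_comp (all id) _ (lc_map s F lF).
by under [X in locally_constant X -> _]funext do rewrite all_map.
Qed.

Lemma lc_has {n} {I : eqType} (s : seq I) (F : I -> shift_space n -> bool) :
    {in s, forall i, locally_constant (F i)} ->
  locally_constant (fun x => has (fun i => F i x) s).
Proof.
move=> lF; have := lc_comp (has id) _ (lc_map s F lF).
by under [X in locally_constant X -> _]funext do rewrite has_map.
Qed.

(** Although [d x] is a minimum over infinitely many tests, its value at [x] is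
    settled by the finitely many tests up to [d x]. *)
Lemma lc_least {n} (P : nat -> shift_space n -> bool) :
    (forall k, locally_constant (P k)) ->
    (forall x, free_part x -> exists k, P k x) ->
  exists d : shift_space n -> nat,
    locally_constant d /\ forall x, free_part x -> P (d x) x.
Proof.
move=> lP exP.
pose d x := if pselect (exists k, P k x) is left e then ex_minn e else 0%N.
have dP x : free_part x ->
    P (d x) x /\ forall k, P k x -> (d x <= k)%N.
  by move=> /exP e; rewrite /d; case: pselect => // e'; case: ex_minnP.
exists d; split=> [x fx|x /dP[]//].
have [w hw] := lc_map (iota 0 (d x).+1) _ (in1W lP) x fx.
exists w => y fy yx; have {hw yx} /eq_in_map e := hw y fy yx.
have [Px minx] := dP x fx; have [Py miny] := dP y fy.
have le_yx : (d y <= d x)%N by rewrite miny// e// mem_iota add0n /=.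
apply/eqP; rewrite eqn_leq le_yx minx// -e// mem_iota /=; lia.
Qed.

Lemma clopen_of_lc {n} (M : shift_space n -> bool) :
  locally_constant M -> clopen_in (@free_part n) [set x | free_part x /\ M x].
Proof.
have op (P : shift_space n -> bool) : locally_constant P ->
    open (set_val @^-1` [set x | P x] : set (set_type (@free_part n))).
  move=> lP; rewrite openE => u /= Pu.
  have [w hw] := lP _ (set_valP u).
  suff near_w : \forall z \near u, {in w, forall h,
      (set_val z : shift_space n) h = (set_val u : shift_space n) h}.
    by apply: filterS near_w => z /(hw _ (set_valP z)) /= ->.
  elim: w {hw} => [|h w IHw]; first by near=> z.
  have cont_h : {for u, continuous (fun z : set_type (@free_part n) =>
      (set_val z : shift_space n) h)}.
    apply: (@continuous_comp _ _ _ set_val (fun x : shift_space n => x h)).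
      exact: initial_continuous.
    exact: (@proj_continuous _ (fun=> bool) h).
  have := cont_h _ (discrete_set1 ((set_val u : shift_space n) h)).
  move=> near_h; near=> z => g; rewrite inE => /orP[/eqP ->|].
    by near: z.
  by move: g; near: z.
move=> lM; have lN : locally_constant (fun x => ~~ M x) by apply: lc_comp.
split=> [x []//|]; have -> : set_val @^-1` [set x | free_part x /\ M x] =
    set_val @^-1` [set x | M x] :> set (set_type (@free_part n)).
  by apply/seteqP; split=> [u []//|u Mu]; split=> //; apply: set_valP.
split; first exact: op.
rewrite -[X in closed X]setCK; apply: open_closedC.
have := op _ lN; congr open.
by apply/seteqP; split=> u /= /negP.
Unshelve. all: by end_near. Qed.

(** * Clopen maximal separated sets *)

(** If [g] is nonzero then [x] and [bshift g x] differ at some coordinate. The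
    colour of [x] is its restriction to the first [d x] coordinates, with [d x]
    least such that they exhibit this difference for all nonzero [g] in [T]. Two
    points with the same colour have the same [d], and [x] and [bshift g x]
    cannot agree on those coordinates. *)
Lemma exists_coloring {n} (T : seq 'rV[int]_n) :
  exists c : shift_space n -> nat, locally_constant c /\
    forall x g, free_part x -> g \in T -> g != 0 -> c (bshift g x) <> c x.
Proof.
pose e i : 'rV[int]_n := odflt 0 (unpickle i).
pose sep k (x : shift_space n) := all (fun g =>
  (g == 0) || has (fun i => x (e i) != x (g + e i)) (iota 0 k)) T.
have [||d [ld dP]] := lc_least sep.
- move=> k; apply: lc_all => g _; apply: lc_comp; apply: lc_has => i _.
  apply: (lc_bind (fun x => x (e i)) (fun b x => b != x (g + e i))).
    exact: lc_eval.
  by move=> b; exact: (lc_comp (fun b' => b != b') _ (lc_eval _)).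
- move=> x fx; rewrite /sep; elim: T {sep} => [|g T [k hk]]; first by exists 0%N.
  have [->|g0] := eqVneq g 0; first by exists k; rewrite /= eqxx.
  have [h hh] : exists h, x h != x (g + h).
    apply: contrapT => /forallNP nh; apply: (fx g); first exact/eqP.
    by apply/funext => h; have /negP/negPn/eqP := nh h.
  exists (k + (pickle h).+1)%N => /=; apply/andP; split.
    apply/orP; right; apply/hasP; exists (pickle h); last by rewrite /e pickleK.
    by rewrite mem_iota; lia.
  apply: sub_all hk => g' /orP[->//|/hasP[i ik hi]]; apply/orP; right.
  by apply/hasP; exists i => //; move: ik; rewrite !mem_iota; lia.
pose pat x := [seq (x : shift_space n) (e i) | i <- iota 0 (d x)].
exists (fun x => pickle (pat x)); split.
  apply: lc_comp; apply: (lc_bind d (fun k x => [seq x (e i) | i <- iota 0 k])).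
    by [].
  by move=> k; apply: lc_map => i _; apply: lc_eval.
move=> x g fx gT g0 /(pcan_inj pickleK) ep.
have ed : d (bshift g x) = d x.
  by have := congr1 size ep; rewrite !size_map !size_iota.
have := dP x fx; move=> /allP/(_ g gT); rewrite (negPf g0) /= => /hasP[i ik].
by move: ep; rewrite /pat ed => /eq_in_map/(_ i ik); rewrite /bshift => ->; rewrite eqxx.
Qed.

(** The greedy algorithm that runs through the colours in increasing order. The
    decision at [x] depends on boundedly many generations of points of smaller
    colour, hence on finitely many coordinates, so the result is clopen even
    though there are infinitely many colours. *)
Lemma exists_maximal {n} (T : seq 'rV[int]_n) (U : shift_space n -> bool) :
    {in T, forall g, - g \in T} -> locally_constant U ->
  exists M : shift_space n -> bool,
    [/\ locally_constant M,
        forall x, free_part x -> M x -> U x,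
        forall x g, free_part x -> g \in T -> M x -> M (bshift g x) -> g = 0
      & forall x, free_part x -> U x ->
          M x \/ exists2 g, g \in T & M (bshift g x)].
Proof.
move=> TN lU; have [c [lc cP]] := exists_coloring T.
(* [mis k] decides correctly at the points of colour smaller than [k]. *)
pose fix mis (k : nat) (x : shift_space n) {struct k} : bool :=
  if k is k'.+1 then
    U x && all (fun g => ~~ ((c (bshift g x) < c x)%N && mis k' (bshift g x))) T
  else false.
have lmis k : locally_constant (mis k).
  elim: k => [|k IHk] /=; first exact: lc_const.
  apply: (lc_bind U (fun b x => b && _)) => // b; apply: lc_comp.
  apply: lc_all => g _; apply: lc_comp.
  apply: (lc_bind c (fun r x => (c (bshift g x) < r)%N && _)) => // r.
  apply: (lc_bind (fun x => c (bshift g x)) (fun b x => (b < r)%N && _)).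
    exact: lc_shift.
  by move=> r'; apply: lc_comp; apply: lc_shift.
pose M x := mis (c x).+1 x.
have misE k x : (c x < k)%N -> mis k x = M x.
  rewrite /M; move: {2}(c x).+1 (ltnSn (c x)) => m.
  elim: m k x => // m IHm [//|k] x cm ck /=; congr (_ && _).
  apply: eq_in_all => g _; case: ltnP => //= cg; congr (~~ _).
  by rewrite !IHm//; apply: leq_trans cg _; lia.
have ME x : M x = U x &&
    all (fun g => ~~ ((c (bshift g x) < c x)%N && M (bshift g x))) T.
  rewrite {1}/M /=; congr (_ && _); apply: eq_in_all => g _.
  by case: ltnP => //= cg; rewrite misE.
exists M; split.
- exact: (lc_bind c (fun k => mis k.+1)).
- by move=> x _; rewrite ME => /andP[].
- have asym x g : free_part x -> g \in T -> M x -> M (bshift g x) ->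
      (c x <= c (bshift g x))%N.
    move=> fx gT; rewrite {1}ME => /andP[_ /allP/(_ g gT)] + Mg.
    by rewrite Mg andbT -leqNgt.
  move=> x g fx gT Mx Mg; apply/eqP; apply/negPn/negP => g0.
  apply: (cP x g fx gT g0); apply/eqP; rewrite eqn_leq asym// andbT.
  have := asym (bshift g x) (- g) (free_part_bshift g _ fx) (TN g gT) Mg.
  by rewrite bshiftD addNr bshift0 => ->.
- move=> x fx Ux; have [Mx|] := boolP (M x); first by left.
  rewrite ME Ux /= => /allPn[g gT /negPn/andP[_ Mg]].
  by right; exists g.
Qed.

(** * Markers along lines *)

(** Separating also by the multiples of [v] below [K] is what forces bounded
    gaps: on a stretch of [K] points without markers nearby, each translate of
    the stretch by a conflict vector contains at most one marker, hence accounts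
    for the rejection of at most one allowed point. *)
Lemma exists_line_markers {n} (v : 'rV[int]_n) (T : seq 'rV[int]_n) (N : nat)
    (U : shift_space n -> bool) :
    v != 0 -> locally_constant U ->
    (forall x, free_part x -> exists2 t, (t < N)%N & U (bshift (v *+ t) x)) ->
  exists (M : shift_space n -> bool) (L : nat),
    [/\ locally_constant M,
        forall x, free_part x -> M x -> U x,
        forall x g, free_part x -> g \in T -> M x -> M (bshift g x) -> g = 0
      & forall x, free_part x -> exists2 a, (a <= L)%N & M (bshift (v *+ a) x)].
Proof.
move=> v0 lU hU; pose T1 := T ++ [seq - g | g <- T].
(* Among [K] consecutive points there are more allowed ones than there are
   conflict vectors in [T1]. *)
pose K := (N * (size T1).+1)%N.
pose T2 := T1 ++ [seq v *+ t | t <- iota 0 K] ++ [seq - (v *+ t) | t <- iota 0 K].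
have T2N : {in T2, forall g, - g \in T2}.
  move=> g; rewrite !mem_cat => /orP[/orP[gT|/mapP[h hT ->]]|/orP[]/mapP[t ht ->]].
  - by rewrite (map_f _ gT) orbT.
  - by rewrite opprK hT.
  - by rewrite (map_f (fun t => - (v *+ t)) ht) !orbT.
  - by rewrite opprK (map_f _ ht) !orbT.
have vT2 t : (t < K)%N -> v *+ t \in T2.
  by move=> tK; rewrite !mem_cat (map_f (fun t => v *+ t)) ?orbT// mem_iota.
have [M [lM MU Msep Mmax]] := exists_maximal T2 U T2N lU.
exists M, (3 * K)%N; split=> //.
  by move=> x g fx gT; apply: Msep => //; rewrite !mem_cat gT.
(* The stretch is the middle third of [0, 3 K], so that conflicts by multiples
   of [v] would produce markers in that interval. *)
move=> x fx; apply: contrapT => noM.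
have {}noM a : (a <= 3 * K)%N -> M (bshift (v *+ a) x) = false.
  by move=> aK; apply/negP => Ma; apply: noM; exists a.
have /choice[t ht] q : exists t, (q * N <= t < q * N + N)%N /\
    U (bshift (v *+ (K + t)) x).
  have [s sN Us] := hU _ (free_part_bshift (v *+ (K + q * N)) x fx).
  exists (q * N + s)%N; split; first lia.
  by rewrite addnA mulrnDr addrC -bshiftD.
have tK q : (q < (size T1).+1)%N -> (t q < K)%N.
  move=> qT; have [/andP[_ tq] _] := ht q; apply: leq_trans tq _.
  by rewrite /K addnC -mulSn mulnC leq_mul2l qT orbT.
have /choice[g gP] q : exists g, (q < (size T1).+1)%N ->
    g \in T1 /\ M (bshift (g + v *+ (K + t q)) x).
  have [qT|] := ltnP q (size T1).+1; last by exists 0.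
  have [_ Uq] := ht q; have tq := tK q qT.
  have [|[g]] := Mmax _ (free_part_bshift _ _ fx) Uq; first by rewrite noM//; lia.
  rewrite bshiftD mem_cat => /orP[gT Mg|]; first by exists g.
  rewrite mem_cat => /orP[]/mapP[s]; rewrite mem_iota => sK ->.
    by rewrite -mulrnDr noM//; lia.
  have -> : v *+ (K + t q) = v *+ s + v *+ (K + t q - s).
    by rewrite -mulrnDr; congr (_ *+ _); lia.
  by rewrite addKr noM//; lia.
have [|//|i [j [ij jT gij]]] := pigeonhole _ T1 (size T1).+1 g.
  by move=> q /gP[].
have iT := ltn_trans ij jT; have [[_ Mi] [_ Mj]] := (gP i iT, gP j jT).
have tij : (t i < t j)%N.
  have [/andP[_ ti] _] := ht i; have [/andP[tj _] _] := ht j.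
  apply: leq_trans ti _; apply: leq_trans tj.
  by rewrite addnC -mulSn leq_mul2r ij orbT.
have : v *+ (t j - t i) = 0.
  have vtT : v *+ (t j - t i) \in T2 by apply: vT2; have := tK j jT; lia.
  apply: (Msep _ _ (free_part_bshift _ _ fx) vtT Mi).
  rewrite bshiftD addrCA -mulrnDr gij.
  by have -> : (t j - t i + (K + t i) = K + t j)%N by lia.
by move/(mulrn_row_eq0 _ _ _ v0); lia.
Qed.

(** The parameters [N] and [T] are chosen for the whole list of directions, so
    that a marker set is already sparse along the directions treated after it.
    Different marker sets only need to avoid [B], a requirement weak enough to
    leave an allowed point among any [N] consecutive ones. *)
Lemma exists_marker_family {n} (B T vs : seq 'rV[int]_n) (N : nat) :
    {in B, forall b, - b \in B} -> {subset B <= T} ->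
    (forall u t, u \in vs -> (t < N)%N -> u *+ t \in T) ->
    (size vs * size B < N)%N -> uniq vs -> 0 \notin vs ->
  exists (M : 'rV[int]_n -> shift_space n -> bool) (L : nat),
    [/\ {in vs, forall v, locally_constant (M v)},
        {in vs, forall v x g, free_part x -> g \in T -> M v x ->
           M v (bshift g x) -> g = 0},
        {in vs &, forall u v x b, free_part x -> u != v -> b \in B ->
           M u x -> ~~ M v (bshift b x)}
      & {in vs, forall v x, free_part x ->
           exists2 a, (a <= L)%N & M v (bshift (v *+ a) x)}].
Proof.
move=> BN BT; elim: vs => [|v vs IHvs] vsT szN; first by exists (fun _ _ => false), 0%N.
rewrite /= inE negb_or => /andP[vvs uvs] /andP[v0 vs0].
have [|||//|M [L [lM Msep Mcross Mhit]]] := IHvs.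
- by move=> u t uvs'; apply: vsT; rewrite inE uvs' orbT.
- by apply: leq_ltn_trans szN; rewrite leq_mul2r leqnSn orbT.
- by [].
(* The points at which no earlier marker set is too close. *)
pose U x := all (fun u => all (fun b => ~~ M u (bshift b x)) B) vs.
have lU : locally_constant U.
  apply: lc_all => u uvs'; apply: lc_all => b _; apply: lc_comp.
  by apply: lc_shift; apply: lM.
have hU x : free_part x -> exists2 t, (t < N)%N & U (bshift (v *+ t) x).
  move=> fx; apply: contrapT => noU.
  have /choice[f fP] t : exists p, (t < N)%N ->
      [/\ p.1 \in vs, p.2 \in B & M p.1 (bshift (p.2 + v *+ t) x)].
    have [tN|] := ltnP t N; last by exists (0, 0).
    have /allPn[u uvs' /allPn[b bB /negPn Mu]] : ~~ U (bshift (v *+ t) x).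
      by apply/negP => Ut; apply: noU; exists t.
    by exists (u, b); rewrite -bshiftD.
  have [t tN||i [j [ij jN fij]]] :=
      pigeonhole _ [seq (u, b) | u <- vs, b <- B] N f.
  - have [? ? _] := fP t tN; rewrite [f t]surjective_pairing.
    by apply: allpairs_f.
  - by rewrite size_allpairs; apply: leq_ltn_trans szN; rewrite leq_mul2r leqnSn orbT.
  have [fvs _ Mi] := fP i (ltn_trans ij jN); have [_ _ Mj] := fP j jN.
  have : v *+ (j - i) = 0.
    have vtT : v *+ (j - i) \in T by apply: vsT; [exact: mem_head|lia].
    apply: (Msep _ fvs _ _ (free_part_bshift _ _ fx) vtT Mi).
    by rewrite bshiftD addrCA -mulrnDr subnK ?fij// ltnW.
  by move/(mulrn_row_eq0 _ _ _); rewrite eq_sym => /(_ v0); lia.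
have [|Mv [Lv [lMv MvU Mvsep Mvhit]]] := exists_line_markers v T N U _ lU hU.
  by rewrite eq_sym.
pose M' u := if u == v then Mv else M u.
have M'v : M' v = Mv by rewrite /M' eqxx.
have M'E u : u \in vs -> M' u = M u.
  by rewrite /M'; case: eqP => // -> vvs'; rewrite vvs' in vvs.
exists M', (maxn L Lv); split.
- by move=> u; rewrite inE => /orP[/eqP->|uvs']; rewrite ?M'v ?M'E//; apply: lM.
- move=> u; rewrite inE => /orP[/eqP->|uvs']; rewrite ?M'v ?M'E//; exact: Msep.
- move=> u1 u2; rewrite !inE => /orP[/eqP->|u1vs] /orP[/eqP->|u2vs] x b fx.
  + by rewrite eqxx.
  + rewrite M'v M'E// => _ bB /(MvU _ fx) /allP/(_ _ u2vs)/allP; exact.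
  + rewrite M'v M'E// => _ bB Mu1; apply/negP => /(MvU _ (free_part_bshift _ _ fx)).
    move=> /allP/(_ _ u1vs)/allP/(_ _ (BN _ bB)).
    by rewrite bshiftD addNr bshift0 Mu1.
  + by rewrite !M'E//; exact: Mcross.
- move=> u; rewrite inE => /orP[/eqP->|uvs'] x fx; rewrite ?M'v ?M'E//.
    by have [a aL Ma] := Mvhit x fx; exists a => //; rewrite leq_max aL orbT.
  by have [a aL Ma] := Mhit _ uvs' x fx; exists a => //; rewrite leq_max aL.
Qed.

(** * The marker theorem *)

Definition box n (d : nat) : seq 'rV[int]_n :=
  [seq \row_i ((f i : nat)%:Z - d%:Z) | f : {ffun 'I_n -> 'I_(2 * d).+1}].

Lemma mem_box n d (g : 'rV[int]_n) :
  (g \in box n d) = [forall i, `|g 0 i| <= d%:Z].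
Proof.
apply/fintype.imageP/forallP => [[f _ ->] i|gd].
  by rewrite mxE; case: (f i) => k /=; lia.
exists [ffun i : 'I_n => inord (absz (g 0 i + d%:Z)) : 'I_(2 * d).+1] => //.
apply/rowP => i; rewrite mxE ffunE; move: (g 0 i) (gd i) => z zd.
by rewrite inordK; lia.
Qed.

Lemma norm2_lt_box (R : realType) n d (g : 'rV[int]_n) :
  norm2 R g < d%:R -> g \in box n d.
Proof.
move=> gd; rewrite mem_box; apply/forallP => i.
rewrite -(ler_int R) intr_norm; apply: le_trans (ltW gd).
rewrite -sqrtr_sqr ler_wsqrtr// (bigD1 i)//= lerDl.
by apply: sumr_ge0 => j _; apply: sqr_ge0.
Qed.

Theorem theorem1p2 (R : realType) (n d0 : nat) (hn : (1 <= n)%N)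
    (hd0 : (1 <= d0)%N) (S : set 'rV[int]_n) (finS : finite_set S)
    (genS : generates S) (S0 : ~ S 0) :
  exists (Delta : nat) (M : set (shift_space n)),
    [/\ (0 < Delta)%N,
        clopen_in (@free_part n) M,
        forall x y : shift_space n, M x -> M y -> x <> y -> shift_orbit x y ->
          d0%:R <= rho R x y
      & forall (v : 'rV[int]_n) (x : shift_space n), S v -> free_part x ->
          exists a b : nat,
            [/\ (a <= Delta)%N, (b <= Delta)%N,
                M (bshift (v *+ a) x) & M (bshift (- (v *+ b)) x)]].
Proof.
have [s Ss] := (finite_seqP S).1 finS; pose vs := undup s.
have memvs v : S v <-> v \in vs by rewrite mem_undup Ss.
pose B := box n d0; pose N := (size vs * size B).+1.
pose T := B ++ [seq v *+ t | v <- vs, t <- iota 0 N].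
have [|||//||M [L [lM Msep Mcross Mhit]]] :=
    exists_marker_family B T vs N _ _ _ _ (undup_uniq s).
- by move=> b; rewrite !mem_box => /forallP bd; apply/forallP => i; rewrite mxE normrN.
- by move=> b bB; rewrite mem_cat bB.
- move=> u t uvs tN; rewrite mem_cat; apply/orP; right.
  by apply/allpairsP; exists (u, t); rewrite mem_iota.
- by apply/negP => /memvs.
have lM' : locally_constant (fun x => has (fun v => M v x) vs).
  exact: lc_has.
(* Starting [L] steps back, the marker is found [L - b] steps before [x]. *)
exists L.+1, [set x | free_part x /\ has (fun v => M v x) vs]; split => //.
- exact: clopen_of_lc.
- move=> x y [fx /hasP[u uvs Mu]] [fy /hasP[v vvs Mv]] xy [g0 _ g0x].
  rewrite leNgt; apply/negP => /norm2_lt_box.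
  have := xgetPex 0 (ex_intro (fun g => bshift g x = y) g0 g0x).
  set g := xget _ _ => /= gx gB; rewrite -gx in Mv.
  have [uv|uv] := eqVneq u v; last first.
    by have := Mcross u v uvs vvs x g fx uv gB Mu; rewrite Mv.
  have g_0 : g = 0.
    by apply: (Msep v vvs x g fx _ _ Mv); rewrite -?uv// mem_cat gB.
  by apply: xy; rewrite -gx g_0 bshift0.
- move=> v x /memvs vvs fx.
  have [a aL Ma] := Mhit v vvs x fx.
  have [b bL Mb] := Mhit v vvs _ (free_part_bshift (- (v *+ L)) _ fx).
  exists a, (L - b)%N; split.
  + exact: leqW.
  + by apply: leqW; apply: leq_subr.
  + by split; [exact: free_part_bshift|apply/hasP; exists v].
  + split; first exact: free_part_bshift.
    by apply/hasP; exists v => //; rewrite mulrnBr// opprB -bshiftD.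
Qed.
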